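(* Let $\mathcal{F}$ be an ETL forest whose accessibility relation $\sim$ is transitive and Euclidean and which is initially synchronous. Then $\mathcal{F}$ has $\mathsf{PR}$ (both $\mathsf{PR_{ee}}$ and $\mathsf{PR_{hc}^\ell}$) if and only if $\mathcal{F}$ has $\mathsf{PR_{hc}^\ell}$.
   Context: Fix a finite set $E$ of events. An ETL forest consists of finitely many pairwise disjoint trees, each a copy of a finite prefix-closed set of event sequences with its own root; its set $H$ of histories is the union of the nodes of all trees, and $\sim\subseteq H\times H$ is an arbitrary relation, possibly relating histories in different trees. Within each tree write $h\leadsto h'$ if $h'=he$ for an event $e$, and $\preceq$ for the prefix relation. $[h]_\sim=\{h':h\sim h'\}$. Euclidean: $h\sim h'$ and $h\sim h''$ imply $h'\sim h''$. Initially synchronous: for any two roots $r,r'$ and any history $h$ with $r\preceq h$ and $r'\sim h$, also $r'\sim r$. For a history $h=e_1\dots e_\ell$ in the tree with root $r$, $\mathrm{EE}(h)$ is the sequence $[r]_\sim,[re_1]_\sim,\dots,[re_1\dots e_\ell]_\sim$; $\mathrm{EE}(h)\approx\mathrm{EE}(h')$ iff equal after collapsing consecutive repeated sets. $\mathsf{PR_{ee}}$: $h\sim h'$ implies $\mathrm{EE}(h)\approx\mathrm{EE}(h')$. $\mathsf{PR_{hc}^\ell}$: for all $h,h'$ and events $e$ with $he\sim h'$: (i) $h\sim h'$, or (ii) $h\sim h''\leadsto h'$ for some $h''$, or (iii) $he\sim h''\leadsto h'$ for some $h''$. *)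

(* Defs.v *)
From HB Require Import structures.
From mathcomp Require Import all_boot.
From mathcomp Require Import finmap.

Set Implicit Arguments.
Unset Strict Implicit.
Unset Printing Implicit Defensive.

Local Open Scope fset_scope.

(* The disjoint copies of the trees are obtained by tagging each event
   sequence with the index of its tree, so that the same sequence occurring in
   two trees gives two histories.  The accessibility relation is boolean, which
   is no restriction since the set of histories is finite. *)
Record etl_forest (E : finType) := EtlForest {
  tree_index : finType;
  tree : tree_index -> {fset seq E};
  tree_nil : forall i, [::] \in tree i;
  tree_prefix_closed :
    forall i (s t : seq E), prefix s t -> t \in tree i -> s \in tree i;
  acc : rel {i : tree_index & tree i}
}.

Section Forest.
Variables (E : finType) (F : etl_forest E).

Definition history : finType := {i : tree_index F & tree i}.

Implicit Types (h k : history) (i j : tree_index F) (e : E).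

Definition tree_of h : tree_index F := tag h.

Definition events h : seq E := val (tagged h).

Definition mk_history i (s : seq E) (s_in : s \in tree i) : history :=
  Tagged (fun i => tree i : Type) [` s_in].

Definition root i : history := mk_history (tree_nil i).

(* [extends h e k] says that the event [e] leads from [h] to the history [k = he]. *)
Definition extends h e k : bool :=
  (tree_of k == tree_of h) && (events k == rcons (events h) e).

Definition leadsto h k : Prop := exists e, extends h e k.

Definition hprefix h k : bool :=
  (tree_of h == tree_of k) && prefix (events h) (events k).

Definition acc_class h : {set history} := [set k | acc h k].

Definition euclidean (T : Type) (R : rel T) : Prop :=
  forall x y z, R x y -> R x z -> R y z.

Definition initially_synchronous : Prop :=
  forall i j h, hprefix (root i) h -> acc (root j) h -> acc (root j) (root i).

Lemma take_events_in h n : take n (events h) \in tree (tree_of h).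
Proof. exact: tree_prefix_closed (prefix_take _ _) (valP (tagged h)). Qed.

Definition take_history n h : history := mk_history (take_events_in h n).

Definition EE h : seq {set history} :=
  [seq acc_class (take_history n h) | n <- iota 0 (size (events h)).+1].

End Forest.

Fixpoint collapse (T : eqType) (s : seq T) : seq T :=
  match s with
  | x :: (y :: _) as t => if x == y then collapse t else x :: collapse t
  | _ => s
  end.

Section PerfectRecall.
Variables (E : finType) (F : etl_forest E).

Definition EE_equiv (h h' : history F) : Prop :=
  collapse (EE h) = collapse (EE h').

Definition PR_ee : Prop :=
  forall h h' : history F, acc h h' -> EE_equiv h h'.

Definition PR_hcl : Prop :=
  forall (h h' he : history F) (e : E), extends h e he -> acc he h' ->
    [\/ acc h h',
        exists h'' : history F, acc h h'' /\ leadsto h'' h'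
      | exists h'' : history F, acc he h'' /\ leadsto h'' h'].

Definition PR : Prop := PR_ee /\ PR_hcl.

End PerfectRecall.

(* Main.v *)
Require Import Defs.
From mathcomp Require Import all_boot.
From mathcomp Require Import finmap zify.

(** Related histories have equal information classes, by transitivity and the
    Euclidean property.  To show that [h ~ h'] implies [EE h ≈ EE h'], let
    [h = ge] and apply the local condition: in each of its three cases [EE h] or
    [EE h'] (or both) arises by appending the common class [[h] = [h']] to the
    sequence of a shorter history, and the induction hypothesis applies to the
    shortened pair.  If [h] is a root, initial synchrony and the Euclidean property
    give [h' ~ r'] for the root [r'] of the tree of [h'], which swaps the sides
    and lets the longer history be shortened. *)

Set Implicit Arguments.
Unset Strict Implicit.
Unset Printing Implicit Defensive.

(** [collapse] recurses from the front, whereas histories grow at the end. *)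
Lemma collapse_rcons2 (T : eqType) (s : seq T) (x y : T) :
  collapse (rcons (rcons s x) y) =
    if x == y then collapse (rcons s x) else rcons (collapse (rcons s x)) y.
Proof.
elim: s => [|a s IHs]; first by rewrite /=; case: eqP => [->|].
(* [collapse] compares the two leading entries; once the tail starts with [b], appending cannot
   affect that comparison. *)
case: s IHs => [|b s] IHs.
  by rewrite /=; case: (eqVneq x y) => [->|_] //; case: (a == x).
have collapse2 t : collapse [:: a, b & t] =
  if a == b then collapse (b :: t) else a :: collapse (b :: t) by [].
rewrite !rcons_cons !collapse2 -!rcons_cons IHs.
by case: (a == b); case: (x == y).
Qed.

Section Forest.
Variables (E : finType) (F : etl_forest E).
Implicit Types h k g : history F.

Lemma history_inj h k : tree_of h = tree_of k -> events h = events k -> h = k.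
Proof.
case: h k => [i s] [j t]; rewrite /tree_of /events /= => ij.
by case: j / ij t => t /val_inj ->.
Qed.

Lemma root_or_extends h :
  h = Defs.root (tree_of h) \/ exists g e, extends g e h.
Proof.
case/lastP hs: (events h) => [|s e].
  by left; apply: history_inj; rewrite ?hs.
right; exists (take_history (size s) h), e.
rewrite /extends /tree_of /= eqxx {2}/events /= hs.
by rewrite -[in take _ _]cats1 take_size_cat.
Qed.

Lemma hprefix_root h : hprefix (Defs.root (tree_of h)) h.
Proof. by rewrite /hprefix eqxx prefix0s. Qed.

Lemma extends_size g e h :
  extends g e h -> size (events h) = (size (events g)).+1.
Proof. by case/andP=> _ /eqP ->; rewrite size_rcons. Qed.

Lemma take_history_size h : take_history (size (events h)) h = h.
Proof. by apply: history_inj; rewrite // {1}/events /= take_size. Qed.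

Lemma EE_rcons h :
  EE h = rcons [seq acc_class (take_history n h) | n <- iota 0 (size (events h))]
               (acc_class h).
Proof. by rewrite /EE -addn1 iotaD map_cat cats1 add0n take_history_size. Qed.

Lemma EE_root (i : tree_index F) :
  EE (Defs.root i) = [:: acc_class (Defs.root i)].
Proof. by rewrite EE_rcons. Qed.

Lemma EE_extends g e h : extends g e h -> EE h = rcons (EE g) (acc_class h).
Proof.
move=> gh; rewrite EE_rcons (extends_size gh); congr rcons.
(* For [n] up to the length of [g], truncating [h] drops [e]. *)
apply/eq_in_map => n; rewrite mem_iota add0n ltnS => /andP[_ n_le].
have /andP[/eqP tree_gh /eqP events_gh] := gh.
congr acc_class; apply: history_inj => //.
by rewrite /events /= -!/(events _) events_gh -cats1 takel_cat.
Qed.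

Lemma collapse_EE_extends g e h : extends g e h ->
  collapse (EE h) = if acc_class g == acc_class h then collapse (EE g)
                    else rcons (collapse (EE g)) (acc_class h).
Proof.
by move=> /EE_extends ->; rewrite EE_rcons collapse_rcons2.
Qed.

Lemma EE_equiv_extends g e h :
  extends g e h -> acc_class g = acc_class h -> EE_equiv h g.
Proof. by move=> /collapse_EE_extends EEh gh; rewrite /EE_equiv EEh gh eqxx. Qed.

Hypotheses (accT : transitive (@acc E F)) (accE : euclidean (@acc E F)).

Lemma acc_class_eq h k : acc h k -> acc_class h = acc_class k.
Proof.
move=> hk; apply/setP => x; rewrite !inE; apply/idP/idP; first exact: accE.
exact: accT.
Qed.

Lemma PR_hcl_PR_ee : initially_synchronous F -> PR_hcl F -> PR_ee F.
Proof.
(* The weight of [h'] pays for the swap from [(root, h')] to [(h', root)]. *)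
move=> sync hcl h h'.
have [n] := ubnP (size (events h) + (size (events h')).*2).
elim: n h h' => // n IHn h h' lt_n hh'.
have class_hh' := acc_class_eq hh'.
have [h_root|[g [e gh]]] := root_or_extends h.
  rewrite h_root in hh' class_hh' *.
  have [h'_root|[g' [e' gh']]] := root_or_extends h'.
    by rewrite /EE_equiv EE_root class_hh' h'_root EE_root.
  have rr' := sync _ _ _ (hprefix_root h') hh'.
  rewrite /EE_equiv (IHn h' (Defs.root (tree_of h'))).
  - by rewrite !EE_root (acc_class_eq rr').
  (* The weight drops strictly because [h'] is not a root. *)
  - have size_h' := extends_size gh'.
    by rewrite (_ : size (events (Defs.root _)) = 0) //; lia.
  - exact: accE hh' rr'.
have size_h := extends_size gh.
have [gh'|[g' [gg' [e' gh']]]|[g' [hg' [e' gh']]]] := hcl _ _ _ _ gh hh'.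
- have class_gh : acc_class g = acc_class h by rewrite (acc_class_eq gh').
  by rewrite /EE_equiv (EE_equiv_extends gh class_gh); apply: IHn => //; lia.
- have size_h' := extends_size gh'.
  (* As [g], [g'] share a class and so do [h], [h'], the last entry is absorbed on both sides or on
     neither. *)
  rewrite /EE_equiv (collapse_EE_extends gh) (collapse_EE_extends gh').
  by rewrite class_hh' (acc_class_eq gg') (IHn g g') //; lia.
- have size_h' := extends_size gh'.
  (* Both classes equal that of [h], so the last step of [h'] only repeats an entry. *)
  have class_gh' : acc_class g' = acc_class h' by rewrite -(acc_class_eq hg').
  by rewrite /EE_equiv (EE_equiv_extends gh' class_gh'); apply: IHn => //; lia.
Qed.

End Forest.

Theorem theorem3 (E : finType) (F : etl_forest E) :
  transitive (@acc E F) -> euclidean (@acc E F) -> initially_synchronous F ->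
  (PR F <-> PR_hcl F).
Proof.
move=> accT accE sync; split=> [[_ //]|hcl].
by split=> //; apply: PR_hcl_PR_ee.
Qed.
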